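(* Let $N,K,L\in\mathbb{N}=\{1,2,\dots\}$ and let $M\in\mathbb{N}$, $M\ge 2$. Let $C=\left(1+\frac1N+\frac1{N^2}+\cdots+\frac1{N^{K-1}}\right)^{-1}$. Consider private information retrieval (PIR) with $N$ databases, each storing all $K$ messages, each message consisting of $L$ symbols from an $M$-ary alphabet, where the downloads consist of symbols from the same $M$-ary alphabet (i.e. $M'=M$). Then the optimal download cost, i.e. the minimum download cost over all (not necessarily linear) PIR schemes, is $$D_L=\left\lceil \frac{L}{C}\right\rceil$$ $M$-ary symbols.
   Context: Notation: $[a:b]=\{a,a+1,\dots,b\}$; $X\sim Y$ means identically distributed. PIR problem. There are $K$ messages $W_1,\dots,W_K$, each an arbitrary string $W_k=(W_k(1),\dots,W_k(L))\in[0:M-1]^L$ (every realization is possible). There are $N$ databases, each storing all the messages. A PIR scheme consists of the following. For each desired index $\theta\in[1:K]$ the user privately generates random queries $Q_1^{[\theta]},\dots,Q_N^{[\theta]}$ (jointly distributed in any way, generated without any knowledge of the message realizations) and sends $Q_n^{[\theta]}$ to database $n$. Database $n$ returns an answering string $A_n^{[\theta]}$, which is a (deterministic) function of $Q_n^{[\theta]}$ and $W_1,\dots,W_K$ and consists of $M'$-ary symbols, $A_n^{[\theta]}\in[0:M'-1]^{|A_n^{[\theta]}|}$; the length $|A_n^{[\theta]}|\ge 0$ of the answer is determined by the query. The scheme must satisfy, for every realization of the messages: [Correctness] for each $\theta\in[1:K]$, $W_\theta$ is a function of $A_1^{[\theta]},\dots,A_N^{[\theta]},Q_1^{[\theta]},\dots,Q_N^{[\theta]}$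 (zero error); [Privacy] $Q_n^{[\theta]}\sim Q_n^{[\theta']}$ for all $\theta,\theta'\in[1:K]$ and $n\in[1:N]$. The download cost of a scheme is $D=\max\sum_{n=1}^N|A_n^{[\theta]}|$, the maximum (over all realizations of the queries, for all $\theta$) of the total number of $M'$-ary symbols downloaded. The optimal download cost $D_L$ is the minimum of $D$ over all PIR schemes with message length $L$ (for the given $N,K,M,M'$). *)

(* Defs.v *)
From mathcomp Require Export all_boot all_order all_algebra.
From mathcomp Require Export all_classical all_reals all_analysis.

Set Implicit Arguments.
Unset Strict Implicit.
Unset Printing Implicit Defensive.

Import Order.TTheory GRing.Theory Num.Theory.
Local Open Scope classical_set_scope.
Local Open Scope ring_scope.

Definition messages (K L M : nat) := {ffun 'I_K -> L.-tuple 'I_M}.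

(* The probability space [pir_space] carries the private randomness of the
   user.  Messages are not random: the queries depend only on the outcome
   [omega], and every requirement is imposed for all messages, so the queries
   are generated without knowledge of the messages.  The realizations of the
   queries are their values at the points of [pir_space].  Taking the same
   space for all desired indices is no restriction, since only the joint law
   of the queries for each fixed index matters. *)
Record pir_scheme (R : realType) (N K L M M' : nat) := PIRScheme {
  pir_disp : measure_display ;
  pir_space : measurableType pir_disp ;
  pir_prob : probability pir_space R ;
  query_disp : 'I_N -> measure_display ;
  query_type : forall n, measurableType (query_disp n) ;
  query : 'I_K -> forall n, {RV pir_prob >-> query_type n} ;
  answer_size : forall n, query_type n -> nat ;
  answer : forall n (q : query_type n),
      messages K L M -> (answer_size q).-tuple 'I_M' ;
  (* Without this, an answer could depend on features of the query that its
     law does not see, e.g. with the trivial sigma-algebra on [query_type n],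
     and privacy would be void. *)
  measurable_answer : forall n (w : messages K L M) (a : seq 'I_M'),
      measurable [set q : query_type n | tval (answer q w) = a] ;
  pir_correct : forall theta : 'I_K,
      exists decode : forall q : (forall n, query_type n),
          (forall n, (answer_size (q n)).-tuple 'I_M') -> L.-tuple 'I_M,
      forall (omega : pir_space) (w : messages K L M),
        decode (fun n => query theta n omega)
               (fun n => answer (query theta n omega) w) = w theta ;
  pir_private : forall (theta theta' : 'I_K) (n : 'I_N)
      (B : set (query_type n)), measurable B ->
      distribution pir_prob (query theta n) B =
      distribution pir_prob (query theta' n) B }.

Definition downloaded (R : realType) (N K L M M' : nat)
    (S : pir_scheme R N K L M M') (theta : 'I_K) (omega : pir_space S) : nat :=
  (\sum_(n < N) answer_size (query S theta n omega))%N.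
Arguments downloaded {R N K L M M'} S theta omega.

(* A scheme whose downloads are unbounded has no finite download cost, and
   hence plays no role in the minimum below. *)
Definition is_download_cost (R : realType) (N K L M M' : nat)
    (S : pir_scheme R N K L M M') (D : nat) : Prop :=
  (exists theta omega, downloaded S theta omega = D) /\
  (forall theta omega, (downloaded S theta omega <= D)%N).

Definition is_optimal_download_cost (R : realType) (N K L M M' : nat)
    (D : nat) : Prop :=
  (exists S : pir_scheme R N K L M M', is_download_cost S D) /\
  (forall (S : pir_scheme R N K L M M') (D' : nat),
      is_download_cost S D' -> (D <= D')%N).

Definition pir_capacity (R : realType) (N K : nat) : R :=
  (\sum_(i < K) (N%:R ^+ i)^-1)^-1.

(* Main.v *)
Require Import Defs.
From HB Require Import structures.
From mathcomp Require Import fingroup perm measurable_realfun zify ring lra.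
Import Order.TTheory GRing.Theory Num.Theory.
Local Open Scope ring_scope.

Set Implicit Arguments.
Unset Strict Implicit.
Unset Printing Implicit Defensive.

(* Put P = N^(K-1) and G = 1 + N + ... + N^(K-1), so that L / C = L G / P.

   Achievability.  Two schemes are concatenated: one retrieves P symbols with
   G downloads, the other retrieves any r < N symbols with r + 1 downloads.
   Writing L = a P + q (N - 1) + r with q (N - 1) + r < P and r < N - 1, this
   costs a G + q N, plus r + 1 if r > 0, and this is less than L / C + 1.

   The scheme for P symbols downloads one symbol for each pair (S, f) of a
   nonempty set S of messages and a list f of |S| - 1 nonzero elements of
   Z/N, from the database with number the sum of f: the sum over k in S of
   one symbol of each W_k.  If theta is in S, the interference is the sum
   already downloaded for S minus theta and f without its last entry, from
   another database because that entry is nonzero.  Hence no database meets a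
   symbol twice, and uniform random relabellings of the symbols of each
   message hide theta.

   Converse.  Let h_k(A) be the average, over all messages, of the logarithm of
   the number of values of the answer A that remain possible once W_1, ..., W_k
   are known.  This averaged Hartley entropy is subadditive and monotone, and by
   concavity of the logarithm h_{k-1}(A) >= L ln M + h_k(A) if A determines W_k.
   With Y_k the sum over the databases of the expectation of h_k, which does
   not depend on theta by privacy, Y_{k-1} >= L ln M + Y_k / N, whereas
   Y_0 <= D ln M. *)

(** * Finite retrieval schemes *)

(* [J] indexes the symbols of a message and [T] the downloaded symbols.  The
   randomness is uniform on [rand], so that queries have equal laws as soon as
   a bijection of [rand] exchanges them. *)
Record code (K N M : nat) (J T : finType) := Code {
  rand : finType;
  rand0 : rand;
  question : finType;
  server : T -> 'I_N;
  ask : 'I_K -> 'I_N -> rand -> question;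
  reply : T -> question -> ('I_K -> J -> 'I_M) -> 'I_M;
  code_correct : forall theta x w w',
    (forall t, reply t (ask theta (server t) x) w =
               reply t (ask theta (server t) x) w') ->
    w theta =1 w' theta;
  code_private : forall theta theta' n, exists2 s : rand -> rand,
    injective s & forall x, ask theta' n (s x) = ask theta n x }.

Definition code_exists (K N M L D : nat) :=
  exists J T : finType, [/\ #|J| = L, #|T| = D & inhabited (code K N M J T)].

Definition void_code K N M : code K N M void void.
Proof.
refine (@Code _ _ _ _ _ unit tt unit (@of_void 'I_N)
  (fun _ _ _ => tt) (fun t => of_void _ t) _ _).
- by move=> theta x w w' _ [].
- by move=> theta theta' n; exists id.
Defined.

(** * Concatenation of codes *)

Section CodeSum.
Variables (K N M : nat) (J1 T1 J2 T2 : finType).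
Variables (c1 : code K N M J1 T1) (c2 : code K N M J2 T2).

Definition sum_reply (t : T1 + T2) (q : question c1 * question c2)
    (w : 'I_K -> J1 + J2 -> 'I_M) :=
  match t with
  | inl t1 => reply t1 q.1 (fun k j => w k (inl j))
  | inr t2 => reply t2 q.2 (fun k j => w k (inr j))
  end.

Definition sum_code : code K N M (J1 + J2)%type (T1 + T2)%type.
Proof.
refine (@Code _ _ _ _ _ (rand c1 * rand c2)%type (rand0 c1, rand0 c2)
  (question c1 * question c2)%type
  (fun t => match t with inl t1 => server c1 t1 | inr t2 => server c2 t2 end)
  (fun theta n x => (ask theta n x.1, ask theta n x.2)) sum_reply _ _).
- move=> theta x w w' eqr [j|j].
  + apply: (@code_correct _ _ _ _ _ c1 theta x.1 (fun k j => w k (inl j))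
      (fun k j => w' k (inl j))) => t; exact: (eqr (inl t)).
  + apply: (@code_correct _ _ _ _ _ c2 theta x.2 (fun k j => w k (inr j))
      (fun k j => w' k (inr j))) => t; exact: (eqr (inr t)).
- move=> theta theta' n.
  have [s1 inj1 E1] := code_private c1 theta theta' n.
  have [s2 inj2 E2] := code_private c2 theta theta' n.
  exists (fun x => (s1 x.1, s2 x.2)) => [[x1 x2] [y1 y2] [/inj1-> /inj2->] //|x].
  by rewrite E1 E2.
Defined.

End CodeSum.

Lemma code_exists0 K N M : code_exists K N M 0 0.
Proof.
by exists void, void; split; rewrite ?card_void //; split; exact: void_code.
Qed.

Lemma code_existsD K N M L1 D1 L2 D2 :
  code_exists K N M L1 D1 -> code_exists K N M L2 D2 ->
  code_exists K N M (L1 + L2) (D1 + D2).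
Proof.
move=> [J1 [T1 [<- <- [c1]]]] [J2 [T2 [<- <- [c2]]]].
by exists (J1 + J2)%type, (T1 + T2)%type; rewrite !card_sum; split=> //; split;
  exact: sum_code.
Qed.

Lemma code_existsM K N M L D a :
  code_exists K N M L D -> code_exists K N M (a * L) (a * D).
Proof.
move=> c; elim: a => [|a IH]; first by rewrite !mul0n; exact: code_exists0.
by rewrite !mulSn; exact: code_existsD.
Qed.

(* The scheme of Tian, Sun and Chen: the requested message is extended by a
   dummy zeroth symbol equal to [0]. *)
Section SmallCode.
Variables (K N M' r : nat).
Hypothesis (rN : (r < N)%N).
Local Notation M := M'.+1.

Definition dummy_ext (v : 'I_r -> 'I_M) (i : 'I_r.+1) : 'I_M :=
  if unlift ord0 i is Some j then v j else 0.

Definition small_ask (theta : 'I_K) (n : 'I_N) (x : {ffun 'I_K -> 'I_r.+1}) :=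
  [ffun k => x k + (if k == theta then inord n else 0)].

Definition small_reply (t : 'I_r.+1) (q : {ffun 'I_K -> 'I_r.+1})
    (w : 'I_K -> 'I_r -> 'I_M) : 'I_M :=
  \sum_k dummy_ext (w k) (q k).

Definition small_code : code K N M 'I_r 'I_r.+1.
Proof.
refine (@Code _ _ _ _ _ {ffun 'I_K -> 'I_r.+1} [ffun=> 0] _
  (widen_ord rN) small_ask small_reply _ _).
- move=> theta x w w' eqr j.
  (* The database numbered [i - x theta] is asked for symbol [i] of the desired message, so every
     [i] is met, under an interference common to all. *)
  have replyE v i : small_reply (i - x theta)
      (small_ask theta (widen_ord rN (i - x theta)) x) v =
      dummy_ext (v theta) i + \sum_(k | k != theta) dummy_ext (v k) (x k).
    rewrite /small_reply (bigD1 theta) //= ffunE eqxx inord_val.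
    rewrite [x theta + _]addrC subrK.
    by congr (_ + _); apply: eq_bigr => k /negPf kt; rewrite ffunE kt addr0.
  (* The dummy symbol is 0, so its reply is the bare interference. *)
  have interference : \sum_(k | k != theta) dummy_ext (w k) (x k) =
                      \sum_(k | k != theta) dummy_ext (w' k) (x k).
    have := eqr (0 - x theta); rewrite !replyE /dummy_ext unlift_none.
    by rewrite !add0r.
  have := eqr (lift ord0 j - x theta).
  by rewrite !replyE interference /dummy_ext liftK => /addIr.
- move=> theta theta' n.
  exists (fun x => [ffun k => small_ask theta n x k
                     - (if k == theta' then inord n else 0)]).
    move=> x y /ffunP exy; apply/ffunP => k; move: (exy k); rewrite !ffunE.
    by move=> /addIr /addIr.
  by move=> x; apply/ffunP => k; rewrite !ffunE subrK.
Defined.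

Lemma code_exists_small : code_exists K N M r r.+1.
Proof.
exists 'I_r, 'I_r.+1; rewrite !card_ord; split=> //; split; exact: small_code.
Qed.

End SmallCode.

(** * Injections extended to permutations, and counts of subsets *)

Lemma inj_on_extend (I : finType) (T : finType) (A : {set T}) (f g : T -> I) :
  {in A &, injective f} -> {in A &, injective g} ->
  exists s : {perm I}, {in A, forall x, s (g x) = f x}.
Proof.
move=> injf injg.
pose enumA (h : T -> I) := [seq h x | x <- enum A].
(* All of [I] is listed with the values of [h] on [A] first; [s] matches equal positions of [list g]
   and [list f]. *)
pose list (h : T -> I) := enumA h ++ [seq i <- enum I | i \notin enumA h].
have uniqA h : {in A &, injective h} -> uniq (enumA h).
  by move=> injh; rewrite map_inj_in_uniq ?enum_uniq // => x y; rewrite !mem_enum;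
    exact: injh.
have uniq_list h : {in A &, injective h} -> uniq (list h).
  move=> injh; rewrite cat_uniq uniqA //= filter_uniq ?enum_uniq // andbT.
  by apply/hasPn => i; rewrite mem_filter => /andP[].
have mem_list h i : i \in list h.
  by rewrite mem_cat mem_filter mem_enum andbT orbN.
have size_list h : {in A &, injective h} -> size (list h) = #|I|.
  move=> injh; rewrite -(card_uniqP (uniq_list _ injh)); apply: eq_card => i.
  by rewrite mem_list.
have idx i : (index i (list g) < size (list f))%N.
  by rewrite size_list // -(size_list g) // index_mem mem_list.
have inj_s : injective (fun i => nth i (list f) (index i (list g))).
  move=> i j /= eij.
  have : index i (list g) = index j (list g).
    apply/eqP; rewrite -(nth_uniq i (idx i) (idx j) (uniq_list _ injf)).
    by rewrite [X in _ == X](set_nth_default j) // eij.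
  by move/(congr1 (nth i (list g))); rewrite !nth_index.
exists (perm inj_s) => x xA; rewrite permE.
have idxA : (index x (enum A) < size (enum A))%N by rewrite index_mem mem_enum.
have nthA i h : nth i (list h) (index x (enum A)) = h x.
  by rewrite nth_cat size_map idxA (nth_map x) // nth_index ?mem_enum.
rewrite -[in index _ _](nthA (g x) g) index_uniq ?nthA ?uniq_list //.
by rewrite size_cat size_map ltn_addr.
Qed.

Lemma sum_set_expn (I : finType) (k : I) (x : nat) :
  (\sum_(S : {set I} | k \in S) x ^ #|S|.-1 = x.+1 ^ #|I|.-1)%N.
Proof.
(* Expanding the product gives a sum over sets [S]; the factor 1 + 0 at [k] kills those without
   [k]. *)
have -> : (x.+1 ^ #|I|.-1 =
    \prod_i ((if i == k then 1 else x) + (if i == k then 0 else 1)))%N.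
  rewrite (bigD1 k) //= eqxx mul1n.
  rewrite (eq_bigr (fun=> x.+1)); last by move=> i /negPf ->; rewrite addn1.
  by rewrite prod_nat_const; congr (_ ^ _)%N; rewrite -(cardC1 k).
rewrite bigA_distr [RHS](bigID (fun S : {set I} => k \in S)) /=.
rewrite [X in (_ = _ + X)%N]big1 ?addn0; last first.
  by move=> S /negPf kS; rewrite (bigD1 k) //= kS eqxx.
apply: eq_bigr => S kS; rewrite (bigD1 k) //= kS eqxx mul1n.
rewrite (bigID (mem S)) /= [X in (_ * X)%N]big1 ?muln1; last first.
  by move=> i /andP[/negPf -> /negPf ->].
rewrite (eq_bigr (fun=> x)); last by move=> i /andP[/negPf -> ->].
rewrite prod_nat_const; congr (_ ^ _)%N; rewrite (cardsD1 k) kS /=.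
by apply: eq_card => i; rewrite !inE.
Qed.

(** Times [x], both sides are [x.+1 ^ #|I| - 1]; sorting [S] by size and Pascal's rule avoid the
    division. *)
Lemma sum_nonempty_set_expn (I : finType) (x : nat) :
  (\sum_(S : {set I} | (0 < #|S|)%N) x ^ #|S|.-1 = \sum_(i < #|I|) x.+1 ^ i)%N.
Proof.
transitivity (\sum_(j < #|I|) 'C(#|I|, j.+1) * x ^ j)%N.
  rewrite (partition_big (fun S : {set I} => inord #|S| : 'I_#|I|.+1) predT) //=.
  rewrite big_ord_recl big1 ?add0n; last first.
    move=> S /andP[S0 /eqP /(congr1 val)].
    rewrite /= inordK; last by rewrite ltnS max_card.
    by move=> /= S00; rewrite S00 in S0.
  apply: eq_bigr => j _; rewrite -card_draws -sum_nat_const.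
  rewrite [RHS](eq_bigl (fun S : {set I} => #|S| == j.+1)); last first.
    by move=> S; rewrite !inE.
  apply: eq_big => [S|S /andP[_ /eqP /(congr1 val)]]; last first.
    by rewrite /= inordK ?ltnS ?max_card // /bump add1n => ->.
  rewrite -val_eqE /= /bump add1n inordK ?ltnS ?max_card // andbC.
  case: eqP => //= Sj.
  by rewrite Sj.
elim: #|I| => [|m IH]; first by rewrite !big_ord0.
rewrite [RHS]big_ord_recr /= -IH -[x.+1]add1n expnDn.
under eq_bigr => j _ do rewrite binS mulnDl.
rewrite big_split /= big_ord_recr /= bin_small // mul0n addn0; congr (_ + _)%N.
by apply: eq_bigr => j _; rewrite exp1n mul1n.
Qed.

Lemma sum_off1_inj (I : finType) (V : zmodType) (f g : {ffun I -> V}) (l : I) :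
  (forall i, i != l -> f i = g i) -> \sum_i f i = \sum_i g i -> f = g.
Proof.
move=> fg; rewrite (bigD1 l) // [RHS](bigD1 l) //= (eq_bigr _ fg) => /addIr fgl.
by apply/ffunP => i; have [->//|/fg] := eqVneq i l.
Qed.

(** * The scheme for [N ^ K'] symbols *)

Section BlockCode.
Variables (K' N' M' : nat).
Local Notation K := K'.+1.
Local Notation N := N'.+1.
Local Notation M := M'.+1.
Local Notation L := (N ^ K')%N.

Definition block := ({set 'I_K} * {ffun 'I_K -> 'I_N})%type.

(** The list of nonzero elements is stored at the positions from 1 to [#|S| - 1] of a function that
    vanishes elsewhere, in particular at 0. *)
Definition increments (S : {set 'I_K}) : pred 'I_K :=
  [pred i : 'I_K | (0 < i < #|S|)%N].

Definition block_ok (b : block) :=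
  (0 < #|b.1|)%N && [forall i, (b.2 i != 0) == increments b.1 i].

Definition block_server (b : block) : 'I_N := \sum_i b.2 i.

Definition block_parent (theta : 'I_K) (b : block) : block :=
  (b.1 :\ theta, [ffun i : 'I_K => if i == #|b.1|.-1 :> nat then 0 else b.2 i]).

(** A block is both a download and a name for symbols. The key names the symbol of message [k] in
    the download [b]; interference reuses the name given by the parent. *)
Definition block_key (theta k : 'I_K) (b : block) : block :=
  if (theta \in b.1) && (k != theta) then block_parent theta b else b.

Definition message_blocks (k : 'I_K) : {set block} :=
  [set b | block_ok b & k \in b.1].

Lemma block_okP (b : block) :
  reflect ((0 < #|b.1|)%N /\ forall i, (b.2 i != 0) = increments b.1 i)
          (block_ok b).
Proof.
apply: (iffP andP) => -[b0 bP]; split=> //.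
  by move/forallP: bP => bP i; exact: (eqP (bP i)).
by apply/forallP => i; apply/eqP.
Qed.

Lemma block_parent_ok theta (b : block) :
  block_ok b -> theta \in b.1 -> (0 < #|b.1 :\ theta|)%N ->
  block_ok (block_parent theta b).
Proof.
move=> /block_okP[b0 bP] tb b1; apply/block_okP; split=> // i.
have cardb : #|b.1| = #|b.1 :\ theta|.+1 by rewrite (cardsD1 theta b.1) tb.
have := bP i; rewrite /= ffunE /increments !inE cardb /= ltnS.
have [-> _|il ->] := eqVneq (i : nat) #|b.1 :\ theta|.
  by rewrite ltnn andbF eqxx.
by rewrite [(i < _)%N]ltn_neqAle il.
Qed.

Lemma block_key_ok theta k (b : block) :
  block_ok b -> k \in b.1 -> block_key theta k b \in message_blocks k.
Proof.
move=> ok kb; rewrite inE /block_key; case: ifP => [/andP[tb kt]|_]; last first.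
  by rewrite ok.
have kbt : k \in b.1 :\ theta by rewrite !inE kt.
by rewrite block_parent_ok //= (cardsD1 k) kbt.
Qed.

Lemma card_filter_sets (P : pred {set 'I_K}) :
  #|[set b : block | block_ok b & P b.1]| =
  (\sum_(S : {set 'I_K} | P S && (0 < #|S|)) N' ^ #|S|.-1)%N.
Proof.
rewrite -sum1_card (eq_bigl (fun b : block => (P b.1 && (0 < #|b.1|)%N) &&
    (b.2 \in pffun_on 0 (increments b.1) (predC1 0)))); last first.
  move=> b; rewrite inE /block_ok andbC andbA; congr (_ && _).
  apply/forallP/pffun_onP => [bP|[/fintype.subsetP bP1 bP2] i].
    split=> [|_ /mapP[i + ->]]; last first.
      by rewrite mem_enum inE => bi; rewrite inE /= (eqP (bP i)).
    by apply/fintype.subsetP => i; rewrite supportE (eqP (bP i)).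
  apply/eqP; apply/idP/idP => bi; first by apply: (bP1 i); rewrite supportE.
  have := bP2 (b.2 i); rewrite inE; apply; apply/mapP.
  by exists i; rewrite ?mem_enum.
rewrite -(pair_big_dep (fun S => P S && (0 < #|S|)%N)
   (fun S f => f \in pffun_on 0 (increments S) (predC1 0)) (fun=> fun=> 1%N)) /=.
apply: eq_bigr => S /andP[_ S0]; rewrite sum1_card card_pffun_on cardC1 card_ord /=.
congr (_ ^ _)%N; rewrite -sum1_card.
rewrite (eq_bigl (fun i : 'I_K => (0 < i < #|S|)%N)) //.
rewrite big_mkcond.
rewrite -(big_mkord predT (fun i => if (0 < i < #|S|)%N then 1%N else 0%N)).
have SK : (#|S| <= K)%N by rewrite -[X in (_ <= X)%N](card_ord K) max_card.
rewrite (@big_cat_nat _ _ _ #|S|) //= [X in (_ + X)%N]big1_seq ?addn0; last first.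
  move=> i; rewrite mem_index_iota /= => /andP[Si _].
  by rewrite [(i < _)%N]ltnNge Si andbF.
rewrite big_ltn // add0n (eq_big_nat _ _ (F2 := fun=> 1%N)); last by move=> i ->.
by rewrite sum_nat_const_nat muln1 subn1.
Qed.

Lemma card_message_blocks k : #|message_blocks k| = L.
Proof.
rewrite [LHS](card_filter_sets (fun S => k \in S)).
rewrite -[K']/(K.-1) -[in RHS](card_ord K) -(sum_set_expn k).
by apply: eq_bigl => S; rewrite (cardsD1 k); case: (k \in S).
Qed.

Lemma card_blocks : #|{: {b : block | block_ok b}}| = (\sum_(i < K) N ^ i)%N.
Proof.
rewrite card_sig -[in RHS](card_ord K) -(sum_nonempty_set_expn _ N').
rewrite -(card_filter_sets predT); apply: eq_card => b.
by rewrite !inE andbT.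
Qed.


(** The parent loses only [theta] and the last entry, and the server, being the sum of the entries,
    gives that entry back. *)
Lemma block_parent_inj theta (b b' : block) :
  theta \in b.1 -> theta \in b'.1 -> block_server b = block_server b' ->
  block_parent theta b = block_parent theta b' -> b = b'.
Proof.
case: b b' => [S f] [S' f'] /= tS tS' eqs [eqS eqf].
have SS' : S = S' by rewrite -(finset.setD1K tS) eqS finset.setD1K.
rewrite -SS' in eqf *; congr pair.
have lS : (#|S|.-1 < K)%N.
  have : (#|S| <= K)%N by rewrite -[X in (_ <= X)%N](card_ord K) max_card.
  by rewrite (cardsD1 theta) tS.
apply: (sum_off1_inj (l := Ordinal lS)) => // i il.
have /ffunP/(_ i) := eqf; rewrite !ffunE.
by case: eqP => // eil; case/eqP: il; apply: val_inj.
Qed.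

Lemma block_parent_server theta k (b : block) :
  block_ok b -> theta \in b.1 -> k \in b.1 -> k != theta ->
  block_server (block_parent theta b) != block_server b.
Proof.
case: b => S f /block_okP[/= S0 fP] tS kS kt.
have cardS : (1 < #|S|)%N.
  by rewrite (cardsD1 theta) tS (cardsD1 k) !inE kt kS.
have SK : (#|S| <= K)%N by rewrite -[X in (_ <= X)%N](card_ord K) max_card.
have lS : (#|S|.-1 < K)%N by lia.
have fl0 : f (Ordinal lS) != 0.
  by rewrite fP /increments /= -subn1 subn_gt0 cardS subn1 ltn_predL.
apply: contraNneq fl0 => eqs.
have fE : (block_parent theta (S, f)).2 = f.
  apply: (sum_off1_inj (l := Ordinal lS)) => // i il.
  by rewrite ffunE; case: eqP => // eil; case/eqP: il; apply: val_inj.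
by rewrite -fE ffunE eqxx.
Qed.

(** If one key is a parent and the other is not, a block and its parent share a database, against
    [block_parent_server]. *)
Lemma block_key_inj theta k n :
  {in [set b | [&& block_ok b, k \in b.1 & block_server b == n]] &,
    injective (block_key theta k)}.
Proof.
move=> b b'; rewrite !inE => /and3P[ok kb /eqP bn] /and3P[ok' kb' /eqP bn'].
rewrite /block_key.
case: ifP => [/andP[tb kt]|_]; case: ifP => [/andP[tb' kt']|_] //.
- by apply: block_parent_inj => //; rewrite bn.
- move=> eqb; have := block_parent_server ok tb kb kt.
  by rewrite eqb bn bn' eqxx.
- move=> eqb; have := block_parent_server ok' tb' kb' kt'.
  by rewrite -eqb bn bn' eqxx.
Qed.


Definition singleton_block (k : 'I_K) : block := ([set k]%SET, [ffun=> 0]).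

Lemma singleton_block_message k : singleton_block k \in message_blocks k.
Proof.
rewrite inE /= set11 andbT; apply/block_okP; rewrite cards1; split=> // i.
by rewrite ffunE eqxx /increments /= cards1; case: (i : nat).
Qed.

Definition block_index (k : 'I_K) (b : block) : 'I_L :=
  cast_ord (card_message_blocks k)
    (enum_rank_in (singleton_block_message k) b).

Lemma block_index_inj k : {in message_blocks k &, injective (block_index k)}.
Proof. by move=> b b' bk bk' /cast_ord_inj /(enum_rank_in_inj bk bk'). Qed.

Lemma block_index_surj k j :
  exists2 b, b \in message_blocks k & block_index k b = j.
Proof.
exists (enum_val (cast_ord (esym (card_message_blocks k)) j)).
  exact: enum_valP.
by rewrite /block_index enum_valK_in cast_ordKV.
Qed.

(** One table covers all blocks: its [None] entries depend on [n] alone, so only the labels could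
    betray [theta]. *)
Definition block_ask (theta : 'I_K) (n : 'I_N) (x : {ffun 'I_K -> {perm 'I_L}}) :=
  [ffun bk : block * 'I_K =>
    if [&& block_ok bk.1, bk.2 \in bk.1.1 & block_server bk.1 == n]
    then Some (x bk.2 (block_index bk.2 (block_key theta bk.2 bk.1)))
    else None].

Definition block_reply (b : block) (q : {ffun block * 'I_K -> option 'I_L})
    (w : 'I_K -> 'I_L -> 'I_M) : 'I_M :=
  \sum_k (if q (b, k) is Some j then w k j else 0).

Lemma block_replyE theta x w (b : block) : block_ok b ->
  block_reply b (block_ask theta (block_server b) x) w =
  \sum_(k in b.1) w k (x k (block_index k (block_key theta k b))).
Proof.
move=> ok; rewrite [RHS]big_mkcond /=; apply: eq_bigr => k _.
by rewrite ffunE /= ok eqxx andbT; case: (k \in b.1).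
Qed.

Lemma block_ask_private theta theta' n :
  exists2 s : {ffun 'I_K -> {perm 'I_L}} -> {ffun 'I_K -> {perm 'I_L}},
    injective s & forall x, block_ask theta' n (s x) = block_ask theta n x.
Proof.
have ext k : exists s : {perm 'I_L},
    {in [set b | [&& block_ok b, k \in b.1 & block_server b == n]], forall b,
      s (block_index k (block_key theta' k b)) =
      block_index k (block_key theta k b)}.
  have inj th : {in [set b | [&& block_ok b, k \in b.1 & block_server b == n]] &,
      injective (fun b => block_index k (block_key th k b))}.
    move=> b b' bk bk' /block_index_inj eb; apply: (block_key_inj bk bk').
    by move: bk bk'; rewrite !inE => /and3P[? ? _] /and3P[? ? _];
      apply: eb; exact: block_key_ok.
  exact: (inj_on_extend (inj theta) (inj theta')).
have [s sP] := fin_all_exists ext.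
(* [s k] acts first and turns the labels for [theta'] into those for [theta]. *)
exists (fun x => [ffun k => s k * x k]%g).
  move=> x y /ffunP exy; apply/ffunP => k; move: (exy k); rewrite !ffunE.
  exact: mulgI.
move=> x; apply/ffunP => -[b k]; rewrite !ffunE /=; case: ifP => // bk.
by rewrite permM sP // inE.
Qed.

Definition block_code : code K N M 'I_L {b : block | block_ok b}.
Proof.
refine (@Code _ _ _ _ _ {ffun 'I_K -> {perm 'I_L}} [ffun=> 1%g] _
  (fun b => block_server (val b)) block_ask (fun b => block_reply (val b))
  _ block_ask_private).
move=> theta x w w' eqr j.
have eq_sum (b : block) : (0 < #|b.1|)%N -> block_ok b ->
    \sum_(k in b.1) w k (x k (block_index k (block_key theta k b))) =
    \sum_(k in b.1) w' k (x k (block_index k (block_key theta k b))).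
  by move=> b0 ok; have := eqr (exist _ b ok); rewrite /= !block_replyE.
(* The desired message has key [b] itself in the block [b], so some block carries its symbol [j]. *)
have [b bt jE] := block_index_surj theta ((x theta)^-1%g j).
move: bt; rewrite inE => /andP[ok tb].
have b0 : (0 < #|b.1|)%N by rewrite (cardsD1 theta) tb.
have := eq_sum b b0 ok; rewrite (big_setD1 theta) //= [in RHS](big_setD1 theta) //=.
rewrite {1 3}/block_key eqxx andbF jE permKV.
have interference v :
    \sum_(k in b.1 :\ theta) v k (x k (block_index k (block_key theta k b))) =
    \sum_(k in (block_parent theta b).1)
      v k (x k (block_index k (block_key theta k (block_parent theta b)))) :> 'I_M.
  apply: eq_bigr => k; rewrite !inE => /andP[kt kb].
  by rewrite /block_key /= !inE eqxx /= tb kt.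
rewrite !interference.
(* A block of one message has no interference; otherwise the parent is itself downloaded. *)
have [bt0|bt0] := posnP #|b.1 :\ theta|.
  rewrite /= (cards0_eq bt0) !big1 ?addr0 // => k; by rewrite inE.
by rewrite eq_sum //; [move/addIr | exact: block_parent_ok].
Defined.

Lemma code_exists_block : code_exists K N M L (\sum_(i < K) N ^ i)%N.
Proof.
exists 'I_L, {b : block | block_ok b}; rewrite card_ord card_blocks; split=> //.
by split; exact: block_code.
Qed.

End BlockCode.

(** * Cost of the best concatenation *)

Lemma code_exists_optimal (K' N' M' L : nat) :
  exists2 D : nat, code_exists K'.+1 N'.+1 M'.+1 L D &
    (D * N'.+1 ^ K' < L * \sum_(i < K'.+1) N'.+1 ^ i + N'.+1 ^ K')%N.
Proof.
set N := N'.+1; set P := (N ^ K')%N; set G := (\sum_(i < _) _)%N.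
have P_gt0 : (0 < P)%N by rewrite expn_gt0.
have NG : (N' * G + 1 = N * P)%N.
  have := predn_exp N K'.+1; rewrite expnS -/P -/G => <-.
  by rewrite addn1 prednK // muln_gt0.
pose a := (L %/ P)%N; pose b := (L %% P)%N.
have bP : (b < P)%N by rewrite ltn_mod.
have {1 2}-> : L = (a * P + b)%N by exact: divn_eq.
have code_a : code_exists K'.+1 N M'.+1 (a * P) (a * G).
  exact/code_existsM/code_exists_block.
(* With one database [P] is 1, so that no remainder [b] is left. *)
case: (posnP N') => [N'0|N'_gt0].
  exists (a * G)%N.
    suff -> : b = 0%N by rewrite addn0.
    by move: bP; rewrite /P /N N'0 exp1n; case: (b).
  by rewrite mulnAC; nia.
pose q := (b %/ N')%N; pose r := (b %% N')%N.
have rN : (r < N')%N by rewrite ltn_mod.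
have bE : b = (q * N' + r)%N by exact: divn_eq.
have code_q : code_exists K'.+1 N M'.+1 (q * N') (q * N).
  by apply/code_existsM/code_exists_small.
have [r0|r_gt0] := posnP r.
  exists (a * G + q * N)%N.
    by apply: code_existsD => //; rewrite bE r0 addn0.
  (* Times [N'], the claim reduces by [NG] to [b < N' * P]. *)
  rewrite -(ltn_pmul2l N'_gt0); move: bE NG; rewrite r0 addn0 /N => bE NG.
  nia.
exists (a * G + (q * N + r.+1))%N.
  apply: code_existsD => //; rewrite bE; apply: code_existsD => //.
  by apply: code_exists_small; rewrite ltnW.
(* Here the same reduction leads to [b < r * P], true because [r] is positive. *)
rewrite -(ltn_pmul2l N'_gt0).
nia.
Qed.

(** * Averaged Hartley entropy *)

(** Jensen's inequality for the concave [ln], multiplied by [#|X|]. *)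
Lemma sum_ln_le (R : realType) (X : finType) (c : X -> R) :
  (0 < #|X|)%N -> (forall x, 0 < c x) ->
  #|X|%:R * ln #|X|%:R + \sum_x ln (c x) <= #|X|%:R * ln (\sum_x c x).
Proof.
move=> X_gt0 c_gt0; set m : R := #|X|%:R; set S := \sum_x c x.
have m_gt0 : 0 < m by rewrite ltr0n.
have S_gt0 : 0 < S.
  have /card_gt0P[x _] := X_gt0.
  by rewrite /S (bigD1 x) //= ltr_pwDl // sumr_ge0 // => y _; exact: ltW.
(* The tangent to [ln] at the mean [S / m]; its linear terms sum to 0. *)
have ln_c x : ln (c x) <= c x * (m / S) - 1 + (ln S - ln m).
  have -> : ln (c x) = ln (1 + (c x * (m / S) - 1)) + (ln S - ln m).
    rewrite [1 + _]addrC subrK lnM ?posrE ?divr_gt0 // ln_div ?posrE //; ring.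
  by rewrite lerD2r le_ln1Dx // ltrBrDl subrr mulr_gt0 ?divr_gt0.
apply: (@le_trans _ _ (m * ln m + \sum_x (c x * (m / S) - 1 + (ln S - ln m)))).
  by rewrite lerD2l; apply: ler_sum => x _.
rewrite big_split /= sumrB -mulr_suml -/S !sumr_const -/m -[_ *+ #|_|]mulr_natl -/m.
by rewrite mulrCA divff ?gt_eqF //; lra.
Qed.

Section Hartley.
Variables (R : realType) (K : nat) (X : finType).
Local Notation W := {ffun 'I_K -> X}.

Definition fiber (k : nat) (w : W) : {set W} :=
  [set w' : W | [forall i : 'I_K, (i < k)%N ==> (w i == w' i)]].

Lemma fiberP k (w w' : W) :
  reflect (forall i : 'I_K, (i < k)%N -> w i = w' i) (w' \in fiber k w).
Proof.
rewrite inE; apply: (iffP forallP) => [ww' i ik|ww' i].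
  by have /implyP/(_ ik)/eqP := ww' i.
by apply/implyP => /ww' ->.
Qed.

Definition nvalues (Y : finType) (f : W -> Y) (k : nat) (w : W) : nat :=
  #|f @: fiber k w|.

(** A sum instead of an average over [w], whence the factor [#|{: W}|] in the bounds below. *)
Definition hartley (Y : finType) (f : W -> Y) (k : nat) : R :=
  \sum_w ln (nvalues f k w)%:R.

Lemma nvalues_gt0 (Y : finType) (f : W -> Y) k w : (0 < nvalues f k w)%N.
Proof.
by apply/card_gt0P; exists (f w); apply: imset_f; apply/fiberP.
Qed.

Lemma hartley_ge0 (Y : finType) (f : W -> Y) k : 0 <= hartley f k.
Proof.
by apply: sumr_ge0 => w _; rewrite ln_ge0 // ler1n nvalues_gt0.
Qed.

Lemma ler_ln_nat (a b : nat) : (0 < a)%N -> (a <= b)%N ->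
  ln (a%:R : R) <= ln b%:R.
Proof.
by move=> a0 ab; rewrite ler_ln ?posrE ?ltr0n ?ler_nat // (leq_trans a0).
Qed.

Lemma hartley_comp (Y Z : finType) (f : W -> Y) (h : Y -> Z) k :
  hartley (h \o f) k <= hartley f k.
Proof.
apply: ler_sum => w _; apply: ler_ln_nat; first exact: nvalues_gt0.
by rewrite /nvalues imset_comp leq_imset_card.
Qed.

Lemma hartley_le_card (Y : finType) (f : W -> Y) k :
  hartley f k <= #|{: W}|%:R * ln #|Y|%:R.
Proof.
apply: (@le_trans _ _ (\sum_(w : W) ln #|Y|%:R)).
  apply: ler_sum => w _; apply: ler_ln_nat; first exact: nvalues_gt0.
  by rewrite max_card.
by rewrite sumr_const mulr_natl cardT.
Qed.

Lemma hartley_subadditive (N : nat) (Y : finType) (F : W -> {ffun 'I_N -> Y}) k :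
  hartley F k <= \sum_(n < N) hartley (fun w => F w n) k.
Proof.
rewrite exchange_big; apply: ler_sum => w _ /=.
have -> : \sum_(n < N) ln (nvalues (fun w' => F w' n) k w)%:R =
    ln ((\prod_(n < N) nvalues (fun w' => F w' n) k w)%N%:R) :> R.
  rewrite natr_prod; pose P (a b : R) := (0 < b) && (a == ln b).
  suff /andP[_ /eqP] : P (\sum_(n < N) ln (nvalues (fun w' => F w' n) k w)%:R)
    (\prod_(n < N) (nvalues (fun w' => F w' n) k w)%:R) by [].
  elim/big_ind2: _ => [|a x b y /andP[x0 /eqP ->] /andP[y0 /eqP ->]|n _].
  - by rewrite /P ltr01 ln1 eqxx.
  - by rewrite /P mulr_gt0 //= lnM ?posrE.
  - by rewrite /P ltr0n nvalues_gt0 eqxx.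
apply: ler_ln_nat; first exact: nvalues_gt0.
(* The values of [F] lie in the product of the value sets of its components. *)
pose box := family (fun n => mem [set F w' n | w' in fiber k w]).
rewrite -[X in (_ <= X)%N](_ : #|box| = _).
  apply: subset_leq_card; apply/fintype.subsetP => _ /imsetP[w' w'k ->].
  by apply/familyP => n; apply: imset_f.
by rewrite card_family foldrE big_map big_enum /=; apply: eq_bigr.
Qed.

Definition update (w : W) (i : 'I_K) (x : X) : W :=
  [ffun j => if j == i then x else w j].

(** Exchanging [x] with entry [i] of [w] is an involution of the pairs, so each message tuple arises
    [#|X|] times. *)
Lemma sum_update (V : nmodType) (i : 'I_K) (g : W -> V) :
  \sum_w \sum_x g (update w i x) = \sum_w g w *+ #|X|.
Proof.
pose swap (p : W * X) := (update p.1 i p.2, p.1 i).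
have swapK : involutive swap.
  move=> [w x]; rewrite /swap /= ffunE eqxx; congr pair.
  by apply/ffunP => j; rewrite !ffunE; case: eqP => [->|].
rewrite pair_big /= (reindex_inj (inv_inj swapK)) /=.
transitivity (\sum_(p : W * X) g p.1).
  by apply: eq_bigr => p _; have /(congr1 fst) /= -> := swapK p.
rewrite -(pair_big xpredT xpredT (fun w _ => g w)) /=.
by apply: eq_bigr => w _; rewrite sumr_const.
Qed.


(** Values coming from different [x] are distinct because [F] determines entry [i], and all of them
    come from [fiber i w]. *)
Lemma sum_nvalues_update (Y : finType) (F : W -> Y) (i : 'I_K) (w : W) :
  (forall w w', F w = F w' -> w i = w' i) ->
  (\sum_x nvalues F i.+1 (update w i x) <= nvalues F i w)%N.
Proof.
move=> Fi; pose A x := [set F w' | w' in fiber i.+1 (update w i x)].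
have memA x y : y \in A x -> exists2 w', y = F w' & w' \in fiber i w /\ w' i = x.
  case/imsetP => w' /fiberP w'P ->; exists w' => //; split.
    apply/fiberP => j ji; rewrite -w'P 1?ltnW // ffunE; case: eqP => // jE.
    by rewrite jE ltnn in ji.
  by rewrite -w'P // ffunE eqxx.
have disjA x x' : x != x' -> [disjoint A x & A x'].
  apply: contraR => /pred0Pn[y /andP[/memA[w1 y1 [_ <-]] /memA[w2 y2 [_ <-]]]].
  by apply/eqP/Fi; rewrite -y1.
rewrite (eq_bigr (fun x => \sum_(y in A x) 1)%N); last first.
  by move=> x _; rewrite sum1_card.
rewrite -(partition_disjoint_bigcup _ (fun=> 1%N) disjA) sum1_card.
apply: subset_leq_card; apply/fintype.subsetP => y /finset.bigcupP[x _].
by case/memA => w' -> [w'k _]; apply: imset_f.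
Qed.

(** Chain rule: for each [w], [sum_ln_le] is applied to the counts obtained as entry [i] varies. *)
Lemma hartley_chain (Y : finType) (F : W -> Y) (i : 'I_K) :
  (0 < #|X|)%N -> (forall w w', F w = F w' -> w i = w' i) ->
  #|{: W}|%:R * ln #|X|%:R + hartley F i.+1 <= hartley F i.
Proof.
move=> X_gt0 Fi; have m_gt0 : 0 < #|X|%:R :> R by rewrite ltr0n.
(* The factor [#|X|] turns the sum over [w] into one over pairs of [w] and [x]. *)
rewrite -(ler_pM2l m_gt0) mulrDr [X in _ + X]mulr_natl -sumrMnl.
rewrite -(sum_update i (fun w => ln (nvalues F i.+1 w)%:R)).
rewrite mulrCA mulr_natl -sumr_const -big_split mulr_sumr /=.
apply: ler_sum => w _; apply: le_trans (sum_ln_le X_gt0 _) _.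
  by move=> x; rewrite ltr0n nvalues_gt0.
rewrite ler_pM2l // -natr_sum ler_ln_nat ?sum_nvalues_update //.
have /card_gt0P[x _] := X_gt0.
by rewrite (bigD1 x) //= addn_gt0 nvalues_gt0.
Qed.

End Hartley.

(** * From finite schemes to probability spaces *)

Local Open Scope classical_set_scope.

Section UniformInitialSegment.
Variables (R : realType) (m : nat).

Definition uniform_nat : set nat -> \bar R :=
  mscale (m.+1%:R^-1)%:nng (msum (fun i : nat => \d_i) m.+1).

HB.instance Definition _ := Measure.on uniform_nat.

Lemma uniform_natE (B : set nat) :
  uniform_nat B = ((m.+1%:R^-1)%:E * \sum_(i < m.+1) \d_(i : nat) B)%E.
Proof. by []. Qed.

Lemma uniform_nat_setT : uniform_nat [set: nat] = 1%E.
Proof.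
rewrite uniform_natE (eq_bigr (fun=> 1%E)); last by move=> i _; exact: diracT.
by rewrite sumEFin -EFinM sumr_const card_ord mulVf.
Qed.

HB.instance Definition _ :=
  Measure_isProbability.Build _ _ _ uniform_nat uniform_nat_setT.

Definition uniform_nat_prob : probability nat R := uniform_nat.

End UniformInitialSegment.

Section NatFun.
Variable f : nat -> nat.

Definition nat_mfun : nat -> nat := f.

Lemma measurable_nat_mfun : measurable_fun [set: nat] nat_mfun.
Proof. by []. Qed.

HB.instance Definition _ :=
  isMeasurableFun.Build _ _ _ _ nat_mfun measurable_nat_mfun.

End NatFun.

(* Coins and queries are encoded as natural numbers, which carry the discrete
   sigma-algebra. *)
Section CodeScheme.
Variables (R : realType) (K' N M' : nat) (J T : finType).
Local Notation K := K'.+1.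
Local Notation M := M'.+1.
Variable c : code K N M J T.

(** Numbers past the enumeration still give a coin: correctness and cost concern every outcome, even
    those of probability 0. *)
Definition coin (i : nat) : rand c := nth (rand0 c) (enum (rand c)) i.

Definition nat_query (theta : 'I_K) (n : 'I_N) (i : nat) : nat :=
  index (ask theta n (coin i)) (enum (question c)).

Definition nat_question (n : 'I_N) (i : nat) : question c :=
  nth (ask ord0 n (rand0 c)) (enum (question c)) i.

Lemma nat_queryK theta n i :
  nat_question n (nat_query theta n i) = ask theta n (coin i).
Proof. by rewrite /nat_question nth_index ?mem_enum. Qed.

Definition code_message (w : messages K #|J| M) (k : 'I_K) (j : J) : 'I_M :=
  tnth (w k) (enum_rank j).

Definition code_answer (n : 'I_N) (i : nat) (w : messages K #|J| M) :=
  map_tuple (fun t => reply t (nat_question n i) (code_message w))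
    (enum_tuple [pred t | server c t == n]).

Definition nat_rv theta n : {RV (uniform_nat_prob R #|rand c|.-1) >-> nat} :=
  nat_mfun (nat_query theta n).

Lemma code_answer_correct theta :
  exists decode : forall q : 'I_N -> nat,
      (forall n : 'I_N, #|[pred t | server c t == n]|.-tuple 'I_M) ->
      #|J|.-tuple 'I_M,
    forall i w, decode (fun n => nat_rv theta n i)
      (fun n => code_answer n (nat_rv theta n i) w) = w theta.
Proof.
(* The decoder picks any message tuple that explains the answers; [code_correct] makes its entry
   [theta] unique. *)
pose explained q a w := exists i,
  q = (fun n => nat_rv theta n i) /\ a = (fun n => code_answer n (q n) w).
exists (fun q a => if pselect (exists w, explained q a w) is left e
  then projT1 (cid e) theta else [tuple ord0 | _ < _]).
move=> i w; case: pselect => [e|[]]; last by exists w, i.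
case: (cid e) => w' /= [i' [qE aE]].
have qn n : ask theta n (coin i') = ask theta n (coin i).
  by rewrite -!nat_queryK; congr nat_question; exact/esym/(congr1 (@^~ n) qE).
apply: eq_from_tnth => j; rewrite -[j]enum_valK.
apply: (@code_correct _ _ _ _ _ c theta (coin i)
  (code_message w') (code_message w)) => t.
have := congr1 val (congr1 (fun a => a (server c t)) aE).
rewrite /= /code_answer /= => /eq_in_map /(_ t).
by rewrite mem_enum inE eqxx nat_queryK => /(_ isT).
Qed.

Lemma code_answer_private (theta theta' : 'I_K) (n : 'I_N) (B : set nat) :
  measurable B ->
  distribution (uniform_nat_prob R #|rand c|.-1) (nat_rv theta n) B =
  distribution (uniform_nat_prob R #|rand c|.-1) (nat_rv theta' n) B.
Proof.
move=> _; have coins : #|rand c|.-1.+1 = #|rand c|.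
  by rewrite prednK //; apply/card_gt0P; exists (rand0 c).
have lawE th : distribution (uniform_nat_prob R #|rand c|.-1) (nat_rv th n) B =
    ((#|rand c|%:R^-1)%:E * \sum_(x : rand c)
      (index (ask th n x) (enum (question c)) \in B)%:R%:E)%E.
  rewrite /distribution /pushforward [LHS]uniform_natE coins.
  congr (_ * _)%E.
  rewrite -[in RHS]big_enum /= (big_nth (rand0 c)) -cardE big_mkord.
  by apply: eq_bigr => i _; rewrite diracE; congr (_%:R%:E);
    apply/idP/idP; rewrite !inE.
rewrite !lawE; congr (_ * _)%E.
have [s s_inj sE] := code_private c theta theta' n.
rewrite [RHS](reindex_inj s_inj) /=; apply: eq_bigr => x _.
by rewrite sE.
Qed.

Definition code_scheme : pir_scheme R N K #|J| M M.
Proof.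
refine (@PIRScheme R N K #|J| M M _ _ (uniform_nat_prob R #|rand c|.-1) _
  (fun=> nat) nat_rv (fun n _ => #|[pred t | server c t == n]|) code_answer _ _ _).
- by [].
- exact: code_answer_correct.
- exact: code_answer_private.
Defined.

Lemma code_scheme_cost : is_download_cost code_scheme #|T|.
Proof.
have costE theta i : downloaded code_scheme theta i = #|T|.
  rewrite /downloaded /= -sum1_card (partition_big (server c) predT) //=.
  by apply: eq_bigr => n _; rewrite sum1_card.
by split=> [|theta i]; [exists ord0, 0%N|]; rewrite costE.
Qed.

End CodeScheme.

(** * The converse *)

(** A preimage under [G \o alpha] is a union of fibres of [alpha], countable through [unpickle]. *)
Lemma measurable_fun_countable d d' (T : measurableType d)
    (U : measurableType d') (C : countType) (alpha : T -> C) (G : C -> U) :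
  (forall y, measurable [set x | alpha x = y]) ->
  measurable_fun [set: T] (G \o alpha).
Proof.
move=> malpha _ B _; rewrite setTI.
have -> : (G \o alpha) @^-1` B = \bigcup_(i : nat) [set x | exists2 y : C,
    unpickle i = Some y & B (G y) /\ alpha x = y].
  apply/seteqP; split => [x Bx|x [i _ [y _ [By xy]]]] /=.
    by exists (pickle (alpha x)) => //=; exists (alpha x); rewrite ?pickleK.
  by rewrite xy.
apply: bigcupT_measurable => i.
case iy : (unpickle i) => [y|]; last first.
  by rewrite [X in measurable X](_ : _ = set0) //; apply/seteqP; split => // x [].
have [By|nBy] := pselect (B (G y)).
  rewrite [X in measurable X](_ : _ = [set x | alpha x = y]) //.
  apply/seteqP; split => [x [_ [<-] []]|x xy] //.
  by exists y.
rewrite [X in measurable X](_ : _ = set0) //.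
by apply/seteqP; split => // x [_ [<-] []].
Qed.

Section Converse.
Variables (R : realType) (N K L M M' : nat).
Hypotheses (N_gt0 : (0 < N)%N) (M_gt0 : (0 < M)%N) (M'_gt0 : (0 < M')%N).
Variables (S : pir_scheme R N K L M M') (D : nat).
Hypothesis downloaded_le : forall theta x, (downloaded S theta x <= D)%N.
Local Notation X := (L.-tuple 'I_M).
Local Notation W := {ffun 'I_K -> X}.

(** The entropy of a query depends on this whole table, which has countably many possible values,
    each taken on a measurable set. *)
Definition answer_map n (q : query_type S n) : {ffun W -> seq 'I_M'} :=
  [ffun w => tval (answer q w)].

Lemma measurable_answer_map n phi :
  measurable [set q : query_type S n | answer_map q = phi].
Proof.
rewrite [X in measurable X](_ : _ = \bigcap_(w in [set: W])
    [set q : query_type S n | tval (answer q w) = phi w]).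
  by apply: fin_bigcap_measurable => // w _; exact: measurable_answer.
apply/seteqP; split => [q /= <- w _|q qphi] /=; first by rewrite ffunE.
by apply/ffunP => w; rewrite ffunE; exact: qphi.
Qed.

(* Makes the answers range over a finite type; the junk value [::] for strings
   longer than [D] is harmless, as these do not answer realized queries. *)
Definition bounded (s : seq 'I_M') : D.-bseq 'I_M' := insub_bseq D s.

Definition answer_entropy k n (q : query_type S n) : R :=
  hartley R (fun w : W => bounded (answer_map q w)) k.

Lemma answer_entropy_ge0 k n (q : query_type S n) : 0 <= answer_entropy k q.
Proof. exact: hartley_ge0. Qed.

Lemma measurable_answer_entropy k n :
  measurable_fun [set: query_type S n] (EFin \o @answer_entropy k n).
Proof.
exact: (@measurable_fun_countable _ _ _ (\bar R) _ _
  (fun phi : {ffun W -> seq 'I_M'} =>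
    (hartley R (fun w : W => bounded (phi w)) k)%:E)
  (@measurable_answer_map n)).
Qed.

Lemma measurable_mean_integrand k theta n : measurable_fun [set: pir_space S]
  (EFin \o (fun x => answer_entropy k (query S theta n x))).
Proof.
have H1 := (@measurable_answer_entropy k n).
have H2 := (@measurable_funPT _ _ _ _ (query S theta n)).
exact: (measurableT_comp H1 H2).
Qed.

Definition mean_entropy k theta n : \bar R :=
  \int[pir_prob S]_x (answer_entropy k (query S theta n x))%:E.

(** The mean is an integral against the law of the query, which privacy makes independent of the
    desired index. *)
Lemma mean_entropy_private k theta theta' n :
  mean_entropy k theta n = mean_entropy k theta' n.
Proof.
have lawE th : mean_entropy k th n =
    (\int[distribution (pir_prob S) (query S th n)]_q (answer_entropy k q)%:E)%E.
  rewrite ge0_integral_distribution //; first exact: measurable_answer_entropy.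
  by move=> q; rewrite lee_fin answer_entropy_ge0.
rewrite !lawE; apply: eq_measure_integral => B mB _.
exact: pir_private.
Qed.

Lemma sum_mean_entropy k theta :
  (\sum_(n < N) mean_entropy k theta n)%E =
  (\int[pir_prob S]_x (\sum_(n < N) answer_entropy k (query S theta n x))%:E)%E.
Proof.
under [RHS]eq_integral => x _ do rewrite -sumEFin.
rewrite ge0_integral_sum //.
- by move=> n; exact: measurable_mean_integrand.
- by move=> n x _; rewrite lee_fin answer_entropy_ge0.
Qed.

Lemma answer_size_le theta x n : (answer_size (query S theta n x) <= D)%N.
Proof.
apply: leq_trans (downloaded_le theta x).
by rewrite /downloaded (bigD1 n) //= leq_addr.
Qed.

Lemma answer_entropy_le n (q : query_type S n) k :
  answer_entropy k q <= #|{: W}|%:R * ((answer_size q)%:R * ln M'%:R).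
Proof.
(* Factoring through tuples of the actual length puts [answer_size q] in the bound, not [D]. *)
have -> : answer_entropy k q =
    hartley R ((fun a : (answer_size q).-tuple 'I_M' => bounded a) \o
               (fun w : W => answer q w)) k.
  by congr hartley; apply/funext => w; rewrite /= ffunE.
apply: le_trans (hartley_comp R _ _ k) _.
apply: le_trans (hartley_le_card R _ k) _.
by rewrite card_tuple card_ord natrX lnXn ?ltr0n // -[ln _ *+ _]mulr_natl.
Qed.

(** For one realization of the queries: subadditivity, then the chain rule, then monotonicity, by
    which the joint entropy is at least the average over the databases. *)
Lemma sum_answer_entropy_chain (theta : 'I_K) x :
  #|{: W}|%:R * (L%:R * ln M%:R) +
    N%:R^-1 * \sum_(n < N) answer_entropy theta.+1 (query S theta n x) <=
  \sum_(n < N) answer_entropy theta (query S theta n x).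
Proof.
pose F (w : W) := [ffun n => bounded (answer_map (query S theta n x) w)].
have X_gt0 : (0 < #|{: X}|)%N by rewrite card_tuple card_ord expn_gt0 M_gt0.
have ln_card : ln #|{: X}|%:R = L%:R * ln M%:R :> R.
  by rewrite card_tuple card_ord natrX lnXn ?ltr0n // mulr_natl.
have answerE k n : answer_entropy k (query S theta n x) =
    hartley R (fun w => F w n) k.
  by congr hartley; apply/funext => w; rewrite [RHS]ffunE.
(* Realized answers have length at most [D], so [bounded] loses nothing and the decoder applies. *)
have decodable (w w' : W) : F w = F w' -> w theta = w' theta.
  move=> /ffunP Fw; have [decode decodeP] := pir_correct S theta.
  rewrite -(decodeP x w) -(decodeP x w'); congr decode.
  apply: functional_extensionality_dep => n.
  apply: val_inj; have := congr1 val (Fw n); rewrite !ffunE /=.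
  by rewrite !insubdK ?unfold_in ?size_tuple ?answer_size_le.
apply: (@le_trans _ _ (hartley R F theta)); last first.
  under eq_bigr do rewrite answerE.
  exact: hartley_subadditive.
apply: le_trans (hartley_chain R X_gt0 decodable); rewrite ln_card lerD2l.
rewrite ler_pdivrMl ?ltr0n // mulr_natl -[X in _ <= _ *+ X](card_ord N) -sumr_const.
apply: ler_sum => n _; rewrite answerE.
exact: (hartley_comp R F (fun y : {ffun 'I_N -> D.-bseq 'I_M'} => y n)).
Qed.


Definition unit_entropy : R := #|{: W}|%:R * (L%:R * ln M%:R).

Lemma unit_entropy_ge0 : 0 <= unit_entropy.
Proof. by rewrite !mulr_ge0 // ln_ge0 // ler1n. Qed.

Lemma measurable_sum_entropy k theta : measurable_fun [set: pir_space S]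
  (EFin \o (fun x => \sum_(n < N) answer_entropy k (query S theta n x))).
Proof.
apply/measurable_EFinP; apply: measurable_sum => n.
exact/measurable_EFinP/measurable_mean_integrand.
Qed.

Lemma sum_entropy_ge0 k theta x :
  0 <= \sum_(n < N) answer_entropy k (query S theta n x).
Proof. by apply: sumr_ge0 => n _; exact: answer_entropy_ge0. Qed.

Lemma integral_pir_cst (r : R) :
  (\int[pir_prob S]_x (cst r%:E) x = r%:E)%E.
Proof. by rewrite integral_cst // [X in (_ * X)%E]probability_setT mule1. Qed.

Lemma mean_entropy_chain (i theta : 'I_K) :
  (unit_entropy%:E + N%:R^-1%:E * (\sum_(n < N) mean_entropy i.+1 theta n) <=
   \sum_(n < N) mean_entropy i theta n)%E.
Proof.
have thetaE k : (\sum_(n < N) mean_entropy k theta n =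
    \sum_(n < N) mean_entropy k i n)%E.
  by apply: eq_bigr => n _; exact: mean_entropy_private.
(* Privacy lets the desired message be [i], the one that the next conditioning reveals. *)
rewrite (thetaE i) (thetaE i.+1).
rewrite !sum_mean_entropy -ge0_integralZl_EFin ?invr_ge0 //; last 2 first.
- by move=> x _; rewrite lee_fin sum_entropy_ge0.
- exact: measurable_sum_entropy.
rewrite -[unit_entropy%:E]integral_pir_cst.
have mZ : measurable_fun [set: pir_space S] (fun x =>
    (N%:R^-1%:E *
     (\sum_(n < N) answer_entropy i.+1 (query S i n x))%:E)%E : \bar R).
  by apply: measurable_funeM; exact: measurable_sum_entropy.
have Z_ge0 x :
    (0 <= N%:R^-1%:E * (\sum_(n < N) answer_entropy i.+1 (query S i n x))%:E)%E.
  by rewrite mule_ge0 // lee_fin ?invr_ge0 ?sum_entropy_ge0.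
rewrite -ge0_integralD //; last by move=> x _; rewrite lee_fin unit_entropy_ge0.
apply: ge0_le_integral => //.
- by move=> x _; rewrite adde_ge0 // lee_fin unit_entropy_ge0.
- exact: emeasurable_funD.
- exact: measurable_sum_entropy.
- by move=> x _; rewrite lee_fin; exact: sum_answer_entropy_chain.
Qed.

(** The recursion is unrolled from full knowledge of the messages, where the bound 0 suffices; each
    step divides the earlier terms by [N]. *)
Lemma mean_entropy_lower (theta : 'I_K) k : (k <= K)%N ->
  ((unit_entropy * \sum_(i < k) (N%:R ^+ i)^-1)%:E <=
   \sum_(n < N) mean_entropy (K - k) theta n)%E.
Proof.
elim: k => [_|k IH kK].
  rewrite big_ord0 mulr0 sume_ge0 // => n _.
  by apply: integral_ge0 => x _; rewrite lee_fin answer_entropy_ge0.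
have iK : (K - k.+1 < K)%N by lia.
apply: le_trans (mean_entropy_chain (Ordinal iK) theta).
have -> : (Ordinal iK).+1 = (K - k)%N by rewrite /=; lia.
have V_ge0 : (0 <= N%:R^-1%:E :> \bar R)%E by rewrite lee_fin invr_ge0.
have := lee_wpmul2l V_ge0 (IH (ltnW kK)).
rewrite -EFinM => /(leeD2l unit_entropy%:E); apply: le_trans.
rewrite -EFinD lee_fin big_ord_recl expr0 invr1 mulrDr mulr1 lerD2l mulrCA.
rewrite ler_wpM2l ?unit_entropy_ge0 // mulr_sumr.
by apply: ler_sum => i _; rewrite lift0 exprS invfM.
Qed.

Lemma mean_entropy_upper (theta : 'I_K) k :
  (\sum_(n < N) mean_entropy k theta n <=
   (#|{: W}|%:R * (D%:R * ln M'%:R))%:E)%E.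
Proof.
rewrite sum_mean_entropy.
rewrite -integral_pir_cst.
have lnM_ge0 : 0 <= ln M'%:R :> R by rewrite ln_ge0 // ler1n.
apply: ge0_le_integral => //.
- by move=> x _; rewrite lee_fin sum_entropy_ge0.
- exact: measurable_sum_entropy.
move=> x _; rewrite lee_fin.
apply: (@le_trans _ _ (\sum_(n < N)
    #|{: W}|%:R * ((answer_size (query S theta n x))%:R * ln M'%:R))).
  by apply: ler_sum => n _; exact: answer_entropy_le.
rewrite -mulr_sumr ler_wpM2l // -mulr_suml ler_wpM2r //.
by rewrite -natr_sum ler_nat; exact: downloaded_le.
Qed.

End Converse.

(** * Matching of the two bounds *)

Lemma download_lower_bound (R : realType) (N K L M D : nat)
    (S : pir_scheme R N K L M M) :
  (0 < N)%N -> (0 < K)%N -> (1 < M)%N ->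
  (forall theta x, (downloaded S theta x <= D)%N) ->
  L%:R * \sum_(i < K) (N%:R ^+ i)^-1 <= D%:R :> R.
Proof.
case: K S => // K S N_gt0 _ M_gt1 downloaded_le.
have M_gt0 : (0 < M)%N by exact: ltnW.
have lnM_gt0 : 0 < ln M%:R :> R by rewrite ln_gt0 // ltr1n.
have W_gt0 : 0 < #|{: messages K.+1 L M}|%:R :> R.
  by rewrite ltr0n card_ffun card_tuple !card_ord !expn_gt0 M_gt0.
(* After all steps of the recursion both bounds concern the entropy given no message; the positive
   factors [#|W|] and [ln M] then cancel. *)
have := le_trans
  (mean_entropy_lower N_gt0 M_gt0 M_gt0 downloaded_le ord0 (leqnn K.+1))
  (mean_entropy_upper M_gt0 downloaded_le ord0 _).

rewrite lee_fin /unit_entropy -!mulrA ler_pM2l // [ln _ * _]mulrC mulrA ler_pM2r //.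
Qed.

Lemma sum_inv_expr (R : realType) (N K' : nat) : (0 < N)%N ->
  (\sum_(i < K'.+1) (N%:R ^+ i)^-1) * N%:R ^+ K' =
  (\sum_(i < K'.+1) N ^ i)%N%:R :> R.
Proof.
move=> N_gt0; rewrite natr_sum mulr_suml (reindex_inj rev_ord_inj) /=.
apply: eq_bigr => i _; rewrite subSS natrX mulrC -expfB_cond ?subKn -1?ltnS //.
by rewrite pnatr_eq0 eqn0Ngt N_gt0 add0n ltnS leq_subr.
Qed.

Theorem theorem1 (R : realType) (N K L M : nat)
  (hN : (0 < N)%N) (hK : (0 < K)%N) (hL : (0 < L)%N) (hM : (1 < M)%N) :
  exists D : nat,
    is_optimal_download_cost R N K L M M D /\
    D%:Z = Num.ceil (L%:R / pir_capacity R N K).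
Proof.
case: N K M hN hK hM => // N' [//|K'] [//|M'] hN hK hM.
have [D [J [T [JL TD [c]]]] D_lt] := code_exists_optimal K' N' M' L.
rewrite -JL -TD in D_lt *; have costS := code_scheme_cost R c.
have lower (S : pir_scheme R N'.+1 K'.+1 #|J| M'.+1 M'.+1) D' :
    is_download_cost S D' ->
    #|J|%:R * \sum_(i < K'.+1) (N'.+1%:R ^+ i)^-1 <= D'%:R :> R.
  by move=> [_ leD]; exact: (download_lower_bound hN hK hM leD).
have D_lt1 : #|T|%:R < #|J|%:R * \sum_(i < K'.+1) (N'.+1%:R ^+ i)^-1 + 1 :> R.
  have P_gt0 : 0 < N'.+1%:R ^+ K' :> R by rewrite exprn_gt0 // ltr0n.
  rewrite -(ltr_pM2r P_gt0) mulrDl -mulrA sum_inv_expr // mul1r.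
  by rewrite -natrX -!natrM -natrD ltr_nat.
exists #|T|; split.
  split=> [|S D' /lower LD']; first by exists (code_scheme R c).
  (* Integrality: [D'] is at least L / C, which exceeds [#|T| - 1]. *)
  by rewrite -ltnS -(ltr_nat R) -[D'.+1]addn1 natrD (lt_le_trans D_lt1) ?lerD2r.
(* The lower bound is applied to the constructed scheme itself. *)
apply/esym/ceil_def; rewrite /pir_capacity invrK intrB ltrBlDr.
by rewrite -[_%:~R]/(#|T|%:R) D_lt1 (lower _ _ costS).
Qed.
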